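(* Let $\alpha$ be an irrational real number. If the irrationality exponent $\mu(\alpha)$ is finite, then the irrationality base satisfies $\beta(\alpha)=1$; equivalently, if the irrationality base of $\alpha$ exceeds $1$, then $\alpha$ is a Liouville number. In particular, a super Liouville number is also a Liouville number.
   Context: Let $\alpha$ be an irrational real number. Irrationality exponent: if there exists $\mu>0$ with the property that for any $\varepsilon>0$ there is a positive integer $q(\varepsilon)$ such that $\left|\alpha-\frac pq\right|>\frac{1}{q^{\mu+\varepsilon}}$ for all integers $p,q$ with $q\ge q(\varepsilon)$, then the least such $\mu$ is denoted $\mu(\alpha)$ and called the irrationality exponent of $\alpha$. If no such $\mu$ exists, one writes $\mu(\alpha)=\infty$ and calls $\alpha$ a Liouville number. Irrationality base: if there exists a real number $\beta\ge 1$ with the property that for any $\varepsilon>0$ there is a positive integer $q(\varepsilon)$ such that $\left|\alpha-\frac pq\right|>\frac{1}{(\beta+\varepsilon)^q}$ for all integers $p,q$ with $q\ge q(\varepsilon)$, then the least such $\beta$ is denoted $\beta(\alpha)$ and called the irrationality base of $\alpha$. If no such $\beta$ exists, one writes $\beta(\alpha)=\infty$ and calls $\alpha$ a super Liouville number. *)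

(* Defs.v *)
From mathcomp Require Import all_boot all_order all_algebra.
From mathcomp Require Import all_classical all_reals all_analysis.

Set Implicit Arguments.
Unset Strict Implicit.
Unset Printing Implicit Defensive.

Import Order.TTheory GRing.Theory Num.Theory.

Local Open Scope classical_set_scope.
Local Open Scope ring_scope.

Definition admissible_exponents (R : realType) (alpha : R) : set R :=
  [set mu : R | 0 < mu /\
    forall eps : R, 0 < eps ->
      exists2 q0 : int, 0 < q0 &
        forall p q : int, q0 <= q ->
          `|alpha - p%:~R / q%:~R| > 1 / (q%:~R `^ (mu + eps))].

Definition admissible_bases (R : realType) (alpha : R) : set R :=
  [set beta : R | 1 <= beta /\
    forall eps : R, 0 < eps ->
      exists2 q0 : int, 0 < q0 &
        forall p q : int, q0 <= q ->
          `|alpha - p%:~R / q%:~R| > 1 / ((beta + eps) ^ q)].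

(* m is the least element of S, with the convention that the value is +oo when
   S is empty; this determines m uniquely. *)
Definition is_least_or_infty (R : realType) (S : set R) (m : \bar R) : Prop :=
  match m with
  | r%:E => S r /\ lbound S r
  | +oo%E => S = set0
  | -oo%E => False
  end.

Definition is_irrationality_exponent (R : realType) (alpha : R) (m : \bar R) :=
  is_least_or_infty (admissible_exponents alpha) m.

Definition is_irrationality_base (R : realType) (alpha : R) (b : \bar R) :=
  is_least_or_infty (admissible_bases alpha) b.

Definition Liouville (R : realType) (alpha : R) : Prop :=
  is_irrationality_exponent alpha +oo%E.

Definition super_Liouville (R : realType) (alpha : R) : Prop :=
  is_irrationality_base alpha +oo%E.

(* Main.v *)
Require Import Defs.
From mathcomp Require Import all_boot all_order all_algebra.
From mathcomp Require Import all_classical all_reals all_analysis.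

(** If [|alpha - p/q| > q^-a] for all large [q], then
    [|alpha - p/q| > (1 + eps)^-q] for all large [q], because [q^a] is
    eventually below [(1 + eps)^q].  So as soon as some exponent is admissible,
    [1] is an admissible base, and it is then the least one. *)

Import Order.TTheory GRing.Theory Num.Theory.

Local Open Scope ring_scope.

(** Halving the logarithm: [ln x] is twice [ln (Num.sqrt x)], and [ln y < y] for positive [y]. *)
Lemma ln_lt_2sqrt (R : realType) (x : R) : 0 < x -> ln x < 2 * Num.sqrt x.
Proof.
move=> x0; have s0 : 0 < Num.sqrt x by rewrite sqrtr_gt0.
rewrite -[in ltLHS](sqr_sqrtr (ltW x0)) lnXn// -[ltLHS]mulr_natl.
by rewrite ltr_pM2l// ln_sublinear.
Qed.

(** In logarithms the goal is [a * ln x <= x * ln b]. As [ln x < 2 * Num.sqrt x], it suffices that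
    [2 * a / ln b <= Num.sqrt x], which is the square root of the bound on [x]. *)
Lemma powR_le_exp (R : realType) (a b x : R) : 0 <= a -> 1 < b -> 0 < x ->
  (2 * a / ln b) ^+ 2 <= x -> x `^ a <= b `^ x.
Proof.
move=> a0 b1 x0 hx.
have lb0 : 0 < ln b by rewrite ln_gt0.
have b0 : 0 < b := lt_trans ltr01 b1.
rewrite -ler_ln ?posrE ?powR_gt0// !ln_powR.
have hs : 2 * a / ln b <= Num.sqrt x.
  by rewrite -(ler_sqrt _ (ltW x0)) sqrtr_sqr in hx; exact: le_trans (ler_norm _) hx.
apply: (@le_trans _ _ (a * (2 * Num.sqrt x))).
  by rewrite ler_wpM2l// ltW// ln_lt_2sqrt.
rewrite ler_pdivrMr// in hs.
rewrite mulrA (mulrC a) -[in leRHS](sqr_sqrtr (ltW x0)) expr2 [leRHS]mulrAC.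
by rewrite ler_wpM2r ?sqrtr_ge0.
Qed.

Lemma admissible_base1 (R : realType) (alpha mu : R) :
  admissible_exponents alpha mu -> admissible_bases alpha 1.
Proof.
move=> [mu0 hmu]; split=> // eps eps0.
(* Any fixed slack in the exponent would do; with [1] the power to beat is [mu + 1]. *)
have [q0 q0_gt0 hq0] := hmu 1 ltr01.
(* [N] exceeds the threshold of [powR_le_exp] for exponent [mu + 1] and base [1 + eps]. *)
pose N := Num.bound ((2 * (mu + 1) / ln (1 + eps)) ^+ 2).
exists (q0 + N%:Z); first by rewrite ltr_wpDr.
move=> p q hq.
have q0q : q0 <= q by apply: le_trans hq; rewrite lerDl.
have Nq : N%:Z <= q by apply: le_trans hq; rewrite lerDr ltW.
have q_gt0 : 0 < q := lt_le_trans q0_gt0 q0q.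
have qR_gt0 : 0 < q%:~R :> R by rewrite ltr0z.
have eps1 : 1 < 1 + eps by rewrite ltrDl.
apply: le_lt_trans (hq0 p q q0q).
have eps1_ge0 : 0 <= 1 + eps := ltW (lt_trans ltr01 eps1).
rewrite !div1r -powR_intmul// lef_pV2 ?posrE ?powR_gt0//; last first.
  exact: lt_trans eps1.
apply: powR_le_exp => //; first by rewrite addr_ge0// ltW.
apply: (@le_trans _ _ N%:R).
  by rewrite ltW// archi_boundP// exprn_even_ge0.
by rewrite pmulrn ler_int.
Qed.

Lemma base_eq1 (R : realType) (alpha mu : R) :
  admissible_exponents alpha mu -> is_irrationality_base alpha 1%:E.
Proof. by move=> /admissible_base1 h; split=> // b []. Qed.

(** An admissible exponent would make [1] an admissible base, against the minimality of a finite
    [b], or against emptiness when [b] is [+oo]. *)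
Lemma base_gt1_Liouville (R : realType) (alpha : R) (b : \bar R) :
  is_irrationality_base alpha b -> (1 < b)%E -> Liouville alpha.
Proof.
move=> hb b1; rewrite /Liouville /is_irrationality_exponent /=.
apply/seteqP; split=> // mu /admissible_base1 h1.
case: b hb b1 => [r [_ /(_ _ h1) r1]|hb _|//].
  by rewrite lte_fin ltNge r1.
by move: h1; have -> : admissible_bases alpha = set0 := hb.
Qed.

Theorem lemma2 (R : realType) (alpha : R) (halpha : irrational alpha) :
  [/\ (forall mu : R, is_irrationality_exponent alpha mu%:E ->
         is_irrationality_base alpha 1%:E),
      (forall b : \bar R, is_irrationality_base alpha b -> (1 < b)%E ->
         Liouville alpha)
    & (super_Liouville alpha -> Liouville alpha)].
Proof.
split.
- by move=> mu [/base_eq1].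
- exact: base_gt1_Liouville.
- by move=> /base_gt1_Liouville; apply; rewrite ltry.
Qed.
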